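(* In the setting described in the context, suppose that the constraints $(-A\xi_p-a_p)^\top x\ge-b^\top\xi_p-d_p$ (or their strict versions $(-A\xi_p-a_p)^\top x>-b^\top\xi_p-d_p$) are in the form of covering or packing. Further, assume that all realizations of $-A\xi_p-a_p$ have the same support and that $\mathcal X\subseteq\mathbb R^L_+$. Then for $i,j\in[N]$ and $p\in[P]$, $$\bar h^j_p(-A\xi^i_p-a_p)\ \ge\ \min\left\{(-A\xi^i_p-a_p)_\ell\,\frac{(-b^\top\xi^j_p-d_p)}{(-A\xi^j_p-a_p)_\ell}:\ \ell\in\mathrm{supp}(-A\xi^i_p-a_p)\right\},$$ where $\mathrm{supp}(-A\xi^i_p-a_p)$ denotes the support of $-A\xi^i_p-a_p$.
   Context: $[n]=\{1,\dots,n\}$. Data: $\mathcal X\subseteq\mathbb R^L$; positive integers $N,P,K_0$; $A\in\mathbb R^{L\times K_0}$, $b\in\mathbb R^{K_0}$, $a_p\in\mathbb R^L$, $d_p\in\mathbb R$ for $p\in[P]$; samples (realizations) $\xi^i_p\in\mathbb R^{K_0}$ of the random vector $\xi_p$ for $i\in[N]$, $p\in[P]$. The constraints are of covering type if $-A\xi_p-a_p\ge 0$ (componentwise) and $-b^\top\xi_p-d_p\ge0$, and of packing type if $-A\xi_p-a_p\le0$ and $-b^\top\xi_p-d_p\le0$. The support of a vector $v\in\mathbb R^L$ is $\mathrm{supp}(v)=\{\ell\in[L]:v_\ell\ne0\}$. For $i,j\in[N]$, $p\in[P]$, $$\bar h^j_p(-A\xi^i_p-a_p)=\min_{x\in\mathcal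 X}\{(-A\xi^i_p-a_p)^\top x:\ (-A\xi^j_p-a_p)^\top x\ge-b^\top\xi^j_p-d_p\}.$$ *)

(* Defs.v *)
(* MathComp-Analysis, over an arbitrary [R : realType]. *)
From HB Require Import structures.
From mathcomp Require Import all_boot all_order all_algebra.
From mathcomp Require Import all_classical all_reals all_analysis.

Set Implicit Arguments.
Unset Strict Implicit.
Unset Printing Implicit Defensive.

Import Order.TTheory GRing.Theory Num.Theory.
Local Open Scope classical_set_scope.
Local Open Scope ring_scope.

Definition dotp (R : realType) (n : nat) (u v : 'cV[R]_n) : R :=
  (u^T *m v) 0 0.

(* [lhs_coef A a z] and [rhs_val b d z] are the coefficient vector -A z - a and
   the right-hand side -b^T z - d of the constraint
   (-A z - a)^T x >= -b^T z - d at a realization [z] of the random vector. *)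
Definition lhs_coef (R : realType) (L K0 : nat)
  (A : 'M[R]_(L, K0)) (a : 'cV[R]_L) (z : 'cV[R]_K0) : 'cV[R]_L :=
  - (A *m z) - a.

Definition rhs_val (R : realType) (K0 : nat)
  (b : 'cV[R]_K0) (d : R) (z : 'cV[R]_K0) : R :=
  - dotp b z - d.

Definition supp (R : realType) (L : nat) (v : 'cV[R]_L) : {set 'I_L} :=
  [set l : 'I_L | v l 0 != 0]%SET.

(* The type of a constraint depends only on its coefficients, hence it is the
   same for the constraint and for its strict version.  The family [z] lists
   the realizations of the random vector. *)
Definition covering (R : realType) (L K0 N : nat) (A : 'M[R]_(L, K0))
  (b : 'cV[R]_K0) (a : 'cV[R]_L) (d : R) (z : 'I_N -> 'cV[R]_K0) : Prop :=
  forall i : 'I_N,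
    (forall l : 'I_L, 0 <= lhs_coef A a (z i) l 0) /\ 0 <= rhs_val b d (z i).

Definition packing (R : realType) (L K0 N : nat) (A : 'M[R]_(L, K0))
  (b : 'cV[R]_K0) (a : 'cV[R]_L) (d : R) (z : 'I_N -> 'cV[R]_K0) : Prop :=
  forall i : 'I_N,
    (forall l : 'I_L, lhs_coef A a (z i) l 0 <= 0) /\ rhs_val b d (z i) <= 0.

Definition nonneg_orthant (R : realType) (L : nat) : set 'cV[R]_L :=
  [set x | forall l : 'I_L, 0 <= x l 0].

(* The optimal value over [X] of the linear objective [c] under the constraint
   at the realization [zj], as an extended real: it is +oo when the problem is
   infeasible, and it is the minimum whenever the minimum is attained. *)
Definition hbar (R : realType) (L K0 : nat) (X : set 'cV[R]_L)
  (A : 'M[R]_(L, K0)) (b : 'cV[R]_K0) (a : 'cV[R]_L) (d : R)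
  (zj : 'cV[R]_K0) (c : 'cV[R]_L) : \bar R :=
  ereal_inf [set (dotp c x)%:E | x in
    [set x | X x /\ dotp (lhs_coef A a zj) x >= rhs_val b d zj]].

(* Main.v *)
Require Import Defs.
From HB Require Import structures.
From mathcomp Require Import all_boot all_order all_algebra.
From mathcomp Require Import all_classical all_reals all_analysis.

Set Implicit Arguments.
Unset Strict Implicit.
Unset Printing Implicit Defensive.

Import Order.TTheory GRing.Theory Num.Theory.
Local Open Scope classical_set_scope.
Local Open Scope ring_scope.

(** Write [c] and [e] for the coefficient vectors of the realizations [i] and
    [j], and [beta] for the right-hand side of the realization [j].  The bound
    is weak duality for the linear program that minimizes [c^T x] subject to
    [e^T x >= beta] and [x >= 0].  Its dual has a single variable [rho], for
    the single constraint; [rho] is feasible when [rho >= 0] and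
    [rho e <= c] componentwise, and its value is [rho beta].

    On the common support the ratios [c_l / e_l] are positive, because [c] and
    [e] have the same sign there.  One of them is dual feasible: the smallest
    one when the entries are nonnegative (covering), the largest one when they
    are nonpositive (packing), since dividing by [e_l < 0] reverses the
    inequality [rho e_l <= c_l].  Off the support both sides of that inequality
    vanish.  So in both cases some index [l] of the support satisfies
    [c_l beta / e_l <= c^T x] for every feasible [x], and the minimum over the
    support is at most its entry at [l]. *)

Lemma dotpE (R : realType) (L : nat) (u v : 'cV[R]_L) :
  dotp u v = \sum_(l < L) u l 0 * v l 0.
Proof. by rewrite /dotp mxE; apply: eq_bigr => l _; rewrite mxE. Qed.

(** Weak duality with one constraint: weighting the componentwise inequalities
    by the nonnegative entries of [x] and adding them bounds [c^T x] below by
    [rho e^T x]. *)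
Lemma dotp_weak_duality (R : realType) (L : nat) (c e x : 'cV[R]_L)
    (beta rho : R) :
  0 <= rho -> (forall l, rho * e l 0 <= c l 0) ->
  nonneg_orthant x -> beta <= dotp e x -> rho * beta <= dotp c x.
Proof.
move=> rho_ge0 rho_le x_ge0 beta_le.
apply: le_trans (ler_wpM2l rho_ge0 beta_le) _.
rewrite !dotpE mulr_sumr; apply: ler_sum => l _.
by rewrite mulrA; apply: ler_wpM2r; [exact: x_ge0 | exact: rho_le].
Qed.

(** An extremal ratio is dual feasible.  Both sign patterns have the same
    conclusion, so that the rest of the argument need not tell them apart. *)
Lemma exists_dual_feasible_ratio (R : realType) (L : nat) (c e : 'cV[R]_L) :
  supp c = supp e -> supp c != finset.set0 ->
  (forall l, 0 <= c l 0 /\ 0 <= e l 0) \/ (forall l, c l 0 <= 0 /\ e l 0 <= 0) ->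
  exists2 k, k \in supp c &
    0 <= c k 0 / e k 0 /\ forall l, c k 0 / e k 0 * e l 0 <= c l 0.
Proof.
move=> supp_ce /set0Pn[k0 k0_supp] sign.
have ratio_ge0 l : 0 <= c l 0 / e l 0.
  case: sign => /(_ l)[c_sign e_sign]; first exact: divr_ge0.
  by apply: mulr_le0 => //; rewrite invr_le0.
have in_suppE l : (l \in supp c) = (e l 0 != 0) by rewrite supp_ce inE.
have off_supp l : l \notin supp c -> c l 0 = 0 /\ e l 0 = 0.
  move=> lN; split; apply/eqP; last by rewrite in_suppE negbK in lN.
  by rewrite inE negbK in lN.
case: sign => sign.
- have [k k_supp k_min] := arg_minP (fun l => c l 0 / e l 0) k0_supp.
  exists k => //; split=> // l.
  have [l_supp|/off_supp[-> ->]] := boolP (l \in supp c); last by rewrite mulr0.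
  have e_gt0 : 0 < e l 0 by rewrite lt_def -in_suppE l_supp; case: (sign l).
  by rewrite -ler_pdivlMr //; exact: k_min.
- have [k k_supp k_max] := arg_maxP (fun l => c l 0 / e l 0) k0_supp.
  exists k => //; split=> // l.
  have [l_supp|/off_supp[-> ->]] := boolP (l \in supp c); last by rewrite mulr0.
  have e_lt0 : e l 0 < 0.
    by rewrite lt_neqAle -in_suppE l_supp; case: (sign l).
  by rewrite -ler_ndivrMr //; exact: k_max.
Qed.

Theorem lemma4 (R : realType) (L N P K0 : nat)
  (N_gt0 : (0 < N)%N) (P_gt0 : (0 < P)%N) (K0_gt0 : (0 < K0)%N)
  (X : set 'cV[R]_L)
  (A : 'M[R]_(L, K0)) (b : 'cV[R]_K0)
  (a : 'I_P -> 'cV[R]_L) (d : 'I_P -> R)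
  (xi : 'I_N -> 'I_P -> 'cV[R]_K0)
  (type_of_constraints : forall p : 'I_P,
     covering A b (a p) (d p) (xi^~ p) \/ packing A b (a p) (d p) (xi^~ p))
  (same_support : forall (p : 'I_P) (i j : 'I_N),
     supp (lhs_coef A (a p) (xi i p)) = supp (lhs_coef A (a p) (xi j p)))
  (X_nonneg : X `<=` nonneg_orthant (R := R) (L := L))
  (i j : 'I_N) (p : 'I_P)
  (supp_nonempty : supp (lhs_coef A (a p) (xi i p)) != finset.set0) :
  (\big[Order.min/+oo]_(l in supp (lhs_coef A (a p) (xi i p)))
      (lhs_coef A (a p) (xi i p) l 0 *
       (rhs_val b (d p) (xi j p) / lhs_coef A (a p) (xi j p) l 0))%:E
   <= hbar X A b (a p) (d p) (xi j p) (lhs_coef A (a p) (xi i p)))%E.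
Proof.
set c := lhs_coef A (a p) (xi i p) in supp_nonempty *.
set e := lhs_coef A (a p) (xi j p).
have sign : (forall l, 0 <= c l 0 /\ 0 <= e l 0) \/
            (forall l, c l 0 <= 0 /\ e l 0 <= 0).
  case: (type_of_constraints p) => sign; [left | right] => l;
    by split; [exact: (sign i).1 | exact: (sign j).1].
have [k k_supp [ratio_ge0 ratio_le]] :=
  exists_dual_feasible_ratio (same_support p i j) supp_nonempty sign.
apply: le_ereal_inf_tmp => _ [x [Xx x_feasible] <-].
rewrite (bigD1 k) //= ge_min lee_fin mulrCA mulrC.
by rewrite (dotp_weak_duality ratio_ge0 ratio_le (X_nonneg _ Xx) x_feasible).
Qed.
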